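(* Let $\mathsf{C2.FSM}$ be $\mathsf{C2.FS}$ plus the McKinsey axiom schema $\Box\Diamond p\to\Diamond\Box p$. Then $\mathsf{C2.FSM}$ is sound and weakly complete with respect to list models: for every $p\in\mathcal{L}_>$, $\vdash_{\mathsf{C2.FSM}}p$ if and only if $p$ is true at every element of every list model.
   Context: Language. Let $At=\{p_0,p_1,\ldots\}$ be a countably infinite set of atoms. $\mathcal{L}_>$ is generated by $p ::= p_k\in At\mid \neg p\mid (p\wedge p)\mid (p>p)$; $\vee,\to,\leftrightarrow$ are defined as usual; $\Box p$ abbreviates $\neg p>p$, and $\Diamond p$ abbreviates $\neg\Box\neg p$. Logics. $\mathsf{C2}$ is the smallest set of $\mathcal{L}_>$-sentences containing all instances of: (PC) every (substitution instance of a) theorem of classical propositional logic; (Identity) $p>p$; (Reciprocity) $(p>q)\wedge(q>p)\wedge(p>r)\to(q>r)$; (MP) $(p>q)\to(p\to q)$; (CEM) $(p>q)\vee(p>\neg q)$; and closed under (Detachment) from $\vdash p\to q$ and $\vdash p$ infer $\vdash q$; (Normality) from $\vdash(p\wedge q)\to r$ infer $\vdash((s>p)\wedge(s>q))\to(s>r)$. $\mathsf{C2.FS}$ is the smallest extension of $\mathsf{C2}$ closed under Detachment and Normality and containing every instance of (Flattening) $(p>((p\wedge q)>r))\leftrightarrow((p\wedge q)>r)$ and of (Sequentiality) $\Box(p\to(\neg p>r))\wedge\Box(q\to(\neg q>r))\to((p\vee q)\to(\neg(p\vee q)>r))$. Adding a schema to a logic means taking the smallest extension containing every instance of the schema and closed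 under Detachment and Normality. Order frames and models. An order frame is a pair $\langle W,<\rangle$ where $W\neq\varnothing$ and $<$ is a function taking each $w\in W$ to a strict well-order $<_w$ on some subset of $W$ such that whenever $x<_w y$, either $w=x$ or $w<_w x$. Put $R(w)=\{w\}\cup\{v: w<_w v\}$. An order model $\langle W,<,V\rangle$ adds a valuation $V:At\times W\to\{0,1\}$; put $V(p_k)=\{w:V(p_k,w)=1\}$. Denotations: $[\![p_k]\!]=V(p_k)$, $[\![\neg p]\!]=W\setminus[\![p]\!]$, $[\![p\wedge q]\!]=[\![p]\!]\cap[\![q]\!]$, and $w\in[\![p>q]\!]$ iff either $R(w)\cap[\![p]\!]=\varnothing$, or there is $y\in R(w)\cap[\![p]\!]\cap[\![q]\!]$ such that $x\notin[\![p]\!]$ whenever $x<_w y$. A sentence $p$ is true at $w$ iff $w\in[\![p]\!]$. Lists. A list over a non-empty set $P$ is a function $\sigma:n\to P$ with $n$ a finite ordinal. For $k\le n$ its $k$th tail $\sigma^{[k:]}$ is the list of length $n-k$ with $\sigma^{[k:]}(j)=\sigma(k+j)$; the rank of $\sigma^{[k:]}$ in $\sigma$ is $k$. The tail order function $\prec^W$ on a set $W$ of lists has $\tau\prec^W_\sigma\rho$ iff $\tau,\rho,\sigma\in W$, $\tau$ and $\rho$ are tails of $\sigma$, and the rank of $\tau$ in $\sigma$ is less than the rank of $\rho$ in $\sigma$. A list frame is an order frame $\langle W,\prec^W\rangle$ where $W$ is a set of lists containing every non-empty tail of each of its members. A list model is an order model based on a list frame. *)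

(* Defs.v *)
From mathcomp Require Import all_boot.
From mathcomp Require Import boolp classical_sets.

Set Implicit Arguments.
Unset Strict Implicit.
Unset Printing Implicit Defensive.

Local Open Scope classical_set_scope.

Inductive form : Type :=
  | Atom of nat
  | Neg of form
  | And of form & form
  | Cond of form & form.

Definition Or (p q : form) : form := Neg (And (Neg p) (Neg q)).
Definition Imp (p q : form) : form := Neg (And p (Neg q)).
Definition Iff (p q : form) : form := And (Imp p q) (Imp q p).
Definition Box (p : form) : form := Cond (Neg p) p.
Definition Dia (p : form) : form := Neg (Box (Neg p)).

Declare Scope form_scope.
Delimit Scope form_scope with form.
Bind Scope form_scope with form.
Notation "¬ p" := (Neg p) (at level 35, right associativity) : form_scope.
Notation "□ p" := (Box p) (at level 35, right associativity) : form_scope.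
Notation "◇ p" := (Dia p) (at level 35, right associativity) : form_scope.
Notation "p ▷ q" := (Cond p q) (at level 60, no associativity) : form_scope.
Notation "p ∧ q" := (And p q) (at level 80, right associativity) : form_scope.
Notation "p ∨ q" := (Or p q) (at level 85, right associativity) : form_scope.
Notation "p → q" := (Imp p q) (at level 90, right associativity) : form_scope.
Notation "p ↔ q" := (Iff p q) (at level 95, no associativity) : form_scope.

(* Formulas of classical propositional logic. They are kept apart from [form]
   so that an instance of (PC) is the image of a tautology under a substitution
   of arbitrary sentences, conditionals included, for its variables. *)
Inductive pform : Type :=
  | PVar of nat
  | PNeg of pform
  | PAnd of pform & pform.

Fixpoint peval (v : nat -> bool) (a : pform) : bool :=
  match a with
  | PVar k => v k
  | PNeg b => ~~ peval v b
  | PAnd b c => peval v b && peval v c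
  end.

Definition tautology (a : pform) : Prop := forall v, peval v a.

Fixpoint psubst (s : nat -> form) (a : pform) : form :=
  match a with
  | PVar k => s k
  | PNeg b => Neg (psubst s b)
  | PAnd b c => And (psubst s b) (psubst s c)
  end.

(* The smallest set of sentences that includes [A] and is closed under the two
   rules of inference. *)
Inductive deductive_closure (A : set form) : set form :=
  | Axiom_instance p : A p -> deductive_closure A p
  | Detachment p q :
      deductive_closure A (p → q)%form -> deductive_closure A p ->
      deductive_closure A q
  | Normality s p q r :
      deductive_closure A ((p ∧ q) → r)%form ->
      deductive_closure A (((s ▷ p) ∧ (s ▷ q)) → (s ▷ r))%form.

Inductive C2_axiom : set form :=
  | PC a s : tautology a -> C2_axiom (psubst s a)
  | Identity p : C2_axiom (p ▷ p)%form
  | Reciprocity p q r :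
      C2_axiom (((p ▷ q) ∧ (q ▷ p) ∧ (p ▷ r)) → (q ▷ r))%form
  | MP p q : C2_axiom ((p ▷ q) → (p → q))%form
  | CEM p q : C2_axiom ((p ▷ q) ∨ (p ▷ ¬ q))%form.

Inductive Flattening : set form :=
  | Flattening_instance p q r :
      Flattening ((p ▷ ((p ∧ q) ▷ r)) ↔ ((p ∧ q) ▷ r))%form.

Inductive Sequentiality : set form :=
  | Sequentiality_instance p q r :
      Sequentiality
        ((□ (p → (¬ p ▷ r)) ∧ □ (q → (¬ q ▷ r))) →
         ((p ∨ q) → (¬ (p ∨ q) ▷ r)))%form.

Inductive McKinsey : set form :=
  | McKinsey_instance p : McKinsey (□ ◇ p → ◇ □ p)%form.

Definition C2 : set form := deductive_closure C2_axiom.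

Definition C2FS : set form :=
  deductive_closure (C2 `|` (Flattening `|` Sequentiality)).

Definition C2FSM : set form := deductive_closure (C2FS `|` McKinsey).

Definition strict_well_order_on {T : Type} (S : set T) (lt : T -> T -> Prop) :
    Prop :=
  [/\ forall x y, lt x y -> S x /\ S y,
      forall x, ~ lt x x,
      forall x y z, lt x y -> lt y z -> lt x z,
      forall x y, S x -> S y -> [\/ lt x y, x = y | lt y x] &
      forall A : set T, A `<=` S -> A !=set0 ->
        exists2 m, A m & forall x, A x -> x <> m -> lt m x].

(* A frame is carried by a set [W] of points of an ambient type [T]; [lt w x y]
   is x <_w y. The values of [lt w], and of valuations at [w], are irrelevant
   when [w] is not in [W]. *)
Definition order_frame {T : Type} (W : set T) (lt : T -> T -> T -> Prop) :
    Prop :=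
  [/\ W !=set0,
      forall w, W w ->
        exists2 S : set T, S `<=` W & strict_well_order_on S (lt w) &
      forall w x y, W w -> lt w x y -> w = x \/ lt w w x].

Definition reach {T : Type} (lt : T -> T -> T -> Prop) (w : T) : set T :=
  [set w] `|` [set v | lt w w v].

Fixpoint denot {T : Type} (W : set T) (lt : T -> T -> T -> Prop)
    (V : nat -> T -> bool) (p : form) : set T :=
  match p with
  | Atom k => W `&` [set w | V k w]
  | Neg q => W `\` denot W lt V q
  | And q r => denot W lt V q `&` denot W lt V r
  | Cond q r =>
      W `&` [set w |
        reach lt w `&` denot W lt V q = set0 \/
        exists2 y, (reach lt w `&` denot W lt V q `&` denot W lt V r) y &
                   forall x, lt w x y -> ~ denot W lt V q x]
  end.

(* [tail_at s k t]: [t] is the [k]th tail of [s]. The bound on [k], which makes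
   the rank of a tail unique, is needed because [drop k s] is empty for every
   [k >= size s]. *)
Definition tail_at {P : Type} (s : seq P) (k : nat) (t : seq P) : Prop :=
  (k <= size s)%N /\ t = drop k s.

Definition tail_order {P : Type} (W : set (seq P)) (s t r : seq P) : Prop :=
  [/\ W t, W r, W s &
      exists i j, [/\ tail_at s i t, tail_at s j r & (i < j)%N]].

Definition list_frame {P : Type} (W : set (seq P)) : Prop :=
  order_frame W (tail_order W) /\
  forall s k t, W s -> tail_at s k t -> t <> [::] -> W t.

(* Main.v *)
Require Import Defs.
From HB Require Import structures.
From mathcomp Require Import all_boot.
From mathcomp Require Import boolp classical_sets.
From mathcomp Require Import zify.

(** On a list, [p > q] says that the first tail satisfying [p], if any, satisfies
    [q]; only the tails matter, so validity in list models is validity over finite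
    sequences of positions with arbitrary valuations.

    For completeness, take a world (a maximal consistent set) and the types of
    worlds over the subformulas of the given sentence. A step from type [a] to
    type [b] is good if it preserves every conditional whose antecedent is false
    at [a]; a type is terminal if every conditional whose antecedent is false at
    it is true at it. Truth and membership coincide along any finite path of good
    steps that ends in a terminal type, so it suffices to reach a terminal type.
    By Flattening, the nearest world whose type is not [a] is a good step away
    from [a]. Sequentiality sums this up over all types reachable from the initial
    one: the disjunction psi of these types implies box psi. The McKinsey axiom
    gives an accessible world where every subformula is necessary or impossible;
    its type is terminal, and reachable by box psi. *)

Set Implicit Arguments.
Unset Strict Implicit.
Unset Printing Implicit Defensive.

(** * Countability of the language *)

Fixpoint tree_of_form (p : form) : GenTree.tree nat :=
  match p with
  | Atom k => GenTree.Leaf k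
  | Neg q => GenTree.Node 0 [:: tree_of_form q]
  | And q r => GenTree.Node 1 [:: tree_of_form q; tree_of_form r]
  | Cond q r => GenTree.Node 2 [:: tree_of_form q; tree_of_form r]
  end.

Fixpoint form_of_tree (t : GenTree.tree nat) : form :=
  match t with
  | GenTree.Leaf k => Atom k
  | GenTree.Node 0 [:: t1] => Neg (form_of_tree t1)
  | GenTree.Node 1 [:: t1; t2] => And (form_of_tree t1) (form_of_tree t2)
  | GenTree.Node _ [:: t1; t2] => Cond (form_of_tree t1) (form_of_tree t2)
  | _ => Atom 0
  end.

Lemma tree_of_formK : cancel tree_of_form form_of_tree.
Proof. by elim=> //= [p -> | p -> q -> | p -> q ->]. Qed.

HB.instance Definition _ := Countable.copy form (can_type tree_of_formK).

(** * Finite sequences *)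

(** A first position satisfying the antecedent is unique if it exists, so the universal clause for
    conditionals also covers the vacuous case. *)
Fixpoint sat (V : nat -> nat -> bool) (n : nat) (p : form) (i : nat) : bool :=
  match p with
  | Atom k => V k i
  | Neg q => ~~ sat V n q i
  | And q r => sat V n q i && sat V n r i
  | Cond q r => `[< forall k, i <= k <= n -> sat V n q k ->
      (forall j, i <= j < k -> ~~ sat V n q j) -> sat V n r k >]
  end.

Lemma sat_CondP V n p q i :
  reflect (forall k, i <= k <= n -> sat V n p k ->
             (forall j, i <= j < k -> ~~ sat V n p j) -> sat V n q k)
          (sat V n (Cond p q) i).
Proof. exact: asboolP. Qed.

Lemma first_occurrence (P : pred nat) i k : i <= k -> P k ->
  exists m, [/\ i <= m <= k, P m & forall j, i <= j < m -> ~~ P j].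
Proof.
move=> ik Pk.
have ex : exists m, (i <= m) && P m by exists k; rewrite ik.
case: (ex_minnP ex) => m /andP[im Pm] min_m; exists m; split=> //.
  by rewrite im min_m // ik.
move=> j /andP[ij jm]; apply/negP => Pj.
by have := min_m j; rewrite ij Pj leqNgt jm => /(_ isT).
Qed.

(** This recursion is what [step_ok] and [end_ok] imitate: when the antecedent fails, the
    conditional passes unchanged to the next position, and at the last one it is vacuously true. *)
Lemma sat_Cond_rec V n p q i : i <= n ->
  sat V n (Cond p q) i =
  if sat V n p i then sat V n q i else (i == n) || sat V n (Cond p q) i.+1.
Proof.
move=> ni; case: ifP => pi.
  apply/sat_CondP/idP => [H | qi k /andP[ik kn] pk min_k].
    by apply: H; rewrite ?leqnn // => j; lia.
  have [<- // | nik] := eqVneq i k.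
  by have := min_k i; rewrite pi leqnn ltn_neqAle nik ik => /(_ isT).
apply/sat_CondP/orP => [H | H k /andP[ik kn] pk min_k].
  have [_ | nin] := eqVneq i n; [by left | right].
  apply/sat_CondP => k /andP[ik kn] pk min_k; apply: H => //; first by rewrite ltnW.
  move=> j /andP[ij jk]; have [<- | nij] := eqVneq i j; first by rewrite pi.
  by apply: min_k; rewrite jk ltn_neqAle nij ij.
have {}ik : i < k.
  by rewrite ltn_neqAle ik andbT; apply/eqP => ik'; rewrite ik' pk in pi.
case: H => [/eqP | /sat_CondP H]; first by lia.
by apply: H; rewrite ?ik // => j /andP[ij jk]; apply: min_k; rewrite jk ltnW.
Qed.

Lemma sat_Box V n p i :
  sat V n (Box p) i <-> forall k, i <= k <= n -> sat V n p k.
Proof.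
split=> [/= /asboolP H k /andP[ik kn] | H].
  apply: contraT => pk.
  have [m [/andP[im mk] pm min_m]] :=
    first_occurrence (P := fun j => ~~ sat V n p j) ik pk.
  have := H m; rewrite im (leq_trans mk kn) => /(_ isT pm min_m).
  by rewrite (negPf pm).
by apply/asboolP => k /H.
Qed.

Lemma sat_Imp V n p q i :
  sat V n (Imp p q) i = (sat V n p i ==> sat V n q i).
Proof. by rewrite /=; case: sat; case: sat. Qed.

Lemma sat_Or V n p q i : sat V n (Or p q) i = sat V n p i || sat V n q i.
Proof. by rewrite /=; case: sat; case: sat. Qed.

Lemma sat_And V n p q i : sat V n (And p q) i = sat V n p i && sat V n q i.
Proof. by []. Qed.

Lemma sat_Iff V n p q i : sat V n (Iff p q) i = (sat V n p i == sat V n q i).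
Proof. by rewrite /=; case: sat; case: sat. Qed.

Lemma sat_psubst V n s a i :
  sat V n (psubst s a) i = peval (fun k => sat V n (s k) i) a.
Proof. by elim: a => //= [a -> | a -> b ->]. Qed.

Lemma sat_Dia V n p i :
  sat V n (Dia p) i <-> exists2 k, i <= k <= n & sat V n p k.
Proof.
split=> [H | [k ik pk]].
  apply: contrapT => nex.
  have : ~~ sat V n (Box (Neg p)) i by [].
  move/negP; apply; apply/sat_Box => k ik /=; apply/negP => pk.
  by apply: nex; exists k.
change (~~ sat V n (Box (Neg p)) i); apply/negP => /sat_Box/(_ k ik) /=.
by rewrite pk.
Qed.

(** * Soundness over finite sequences *)

Definition finitely_valid : set form :=
  fun p => forall V n i, i <= n -> sat V n p i.

(** For Normality, both premises concern the same first position satisfying [s]. The set [A] is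
    arbitrary because the logics are nested closures. *)
Lemma deductive_closure_finitely_valid (A : set form) :
  (forall p, A p -> finitely_valid p) ->
  forall p, deductive_closure A p -> finitely_valid p.
Proof.
move=> HA p; elim=> {p} [p /HA // | p q _ IHpq _ IHp | s p q r _ IH] V n i ni.
  by have := IHpq V n i ni; rewrite sat_Imp (IHp V n i ni).
rewrite sat_Imp; apply/implyP => /= /andP[/asboolP sp /asboolP sq].
apply/asboolP => k ik sk min_k.
have kn : k <= n by case/andP: ik.
have := IH V n k kn; rewrite sat_Imp /= (sp k ik sk min_k) (sq k ik sk min_k).
by [].
Qed.

Lemma C2_axiom_finitely_valid p : C2_axiom p -> finitely_valid p.
Proof.
case=> {p} [a s ta | p | p q r | p q | p q] V n i ni.
- by rewrite sat_psubst ta.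
- by apply/asboolP.
- rewrite sat_Imp; apply/implyP => /= /and3P[/asboolP pq /asboolP qp /asboolP pr].
  apply/asboolP => k /andP[ik kn] qk min_k.
  have pk : sat V n p k by apply: qp; rewrite ?ik.
  have [m [/andP[im mk] pm min_m]] := first_occurrence ik pk.
  have qm : sat V n q m by apply: pq; rewrite ?im ?(leq_trans mk kn).
  (* Already [q] holds at [m <= k], while [k] is the first position satisfying [q]. *)
  have km : k = m.
    apply/eqP; rewrite eqn_leq mk andbT leqNgt; apply/negP => mltk.
    by have := min_k m; rewrite im mltk qm => /(_ isT).
  by rewrite km; apply: pr; rewrite ?im ?(leq_trans mk kn).
- rewrite !sat_Imp; apply/implyP => /= /asboolP pq; apply/implyP => pi.
  by apply: pq; rewrite ?leqnn // => j; lia.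
- rewrite sat_Or; apply/orP.
  have [?|npq] := boolP (sat V n (Cond p q) i); [by left | right].
  apply/sat_CondP => k ik pk min_k /=; apply: contra npq => qk.
  apply/sat_CondP => m im pm min_m.
  suff -> : m = k by [].
  have [mk | km | //] := ltngtP m k.
    by have := min_k m; rewrite pm mk; case/andP: im => -> _ /(_ isT).
  by have := min_m k; rewrite pk km; case/andP: ik => -> _ /(_ isT).
Qed.

(** The first position with [And p q] cannot precede the first with [p], so starting the search at
    the latter finds the same position. *)
Lemma Flattening_finitely_valid p : Flattening p -> finitely_valid p.
Proof.
case=> {}p q r V n i ni; rewrite sat_Iff; apply/eqP.
apply/sat_CondP/sat_CondP => H k /andP[ik kn].
  rewrite sat_And => /andP[pk qk] min_k.
  have [m [/andP[im mk] pm min_m]] := first_occurrence ik pk.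
  have := H m; rewrite im (leq_trans mk kn) => /(_ isT pm min_m) /sat_CondP; apply.
  - by rewrite mk.
  - by rewrite sat_And pk.
  - by move=> j /andP[mj jk]; apply: min_k; rewrite jk (leq_trans im mj).
move=> pk min_k; apply/sat_CondP => m /andP[km mn] pqm min_m.
apply: H => //; first by rewrite (leq_trans ik km).
move=> j /andP[ij jm]; have [kj | jk] := leqP k j; first by rewrite min_m ?kj.
by rewrite sat_And negb_and min_k ?ij.
Qed.

(** Just before the first failure [k] of [Or p q], one disjunct holds. It fails at [k], so its own
    premise, applied at [k.-1], gives [r] at [k]. *)
Lemma Sequentiality_finitely_valid p : Sequentiality p -> finitely_valid p.
Proof.
case=> {}p q r V n i ni.
rewrite sat_Imp sat_And; apply/implyP => /andP[/sat_Box bp /sat_Box bq].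
rewrite sat_Imp; apply/implyP => pqi; apply/sat_CondP => k /andP[ik kn].
have satN s j : sat V n (Neg s) j = ~~ sat V n s j by [].
rewrite satN => npqk min_k.
have {}ik : i < k.
  by rewrite ltn_neqAle ik andbT; apply: contraNneq npqk => <-.
have step s : (forall j, i <= j <= n -> sat V n (Imp s (Cond (Neg s) r)) j) ->
    sat V n s k.-1 -> ~~ sat V n s k -> sat V n r k.
  move=> bs sk1 nsk; have ik1 : i <= k.-1 <= n by lia.
  have := bs k.-1 ik1; rewrite sat_Imp sk1 implyTb => /sat_CondP; apply=> //; first by lia.
  by move=> j jk; rewrite satN negbK (_ : j = k.-1) //; lia.
have : sat V n (Or p q) k.-1 by have := min_k k.-1; rewrite satN negbK; apply; lia.
move: npqk; rewrite !sat_Or negb_or => /andP[npk nqk] /orP[sk|sk].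
- exact: (step p).
- exact: (step q).
Qed.

(** The last position [n] is accessible from everywhere and sees only itself, so there possibility,
    truth and necessity coincide. *)
Lemma McKinsey_finitely_valid p : McKinsey p -> finitely_valid p.
Proof.
case=> {}p V n i ni; rewrite sat_Imp; apply/implyP => /sat_Box H.
have /sat_Dia[k kn pk] := H n ltac:(lia).
apply/sat_Dia; exists n; first by lia.
by apply/sat_Box => j jn; have -> : j = k by lia.
Qed.

Lemma C2FSM_finitely_valid p : C2FSM p -> finitely_valid p.
Proof.
apply: deductive_closure_finitely_valid => {}p [|/McKinsey_finitely_valid //].
apply: deductive_closure_finitely_valid => {}p [|[]]; first last.
- exact: Sequentiality_finitely_valid.
- exact: Flattening_finitely_valid.
by apply: deductive_closure_finitely_valid => {}p /C2_axiom_finitely_valid.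
Qed.

(** * List frames *)

Section ListFrames.
Variables (P : Type) (W : set (seq P)).

Lemma tail_order_drop (w : seq P) i a b : a <= size w -> b <= size w ->
  W (drop i w) -> W (drop a w) -> W (drop b w) -> i <= a -> i <= b ->
  tail_order W (drop i w) (drop a w) (drop b w) <-> a < b.
Proof.
move=> aw bw Wi Wa Wb ia ib; split=> [[_ _ _ [k [l [[kw /(congr1 size) Ek]]]]] | ab].
  by case=> lw /(congr1 size); move: Ek kw lw; rewrite !size_drop; lia.
split=> //; exists (a - i), (b - i); rewrite /tail_at size_drop !drop_drop.
by rewrite !subnK //; split; [split; [lia|] .. | lia].
Qed.

(** The bound [n] is kept apart from [size w] because the empty list may or may not be a point of
    [W]: the last rank is [size w] or [(size w).-1] accordingly. *)
Lemma reach_drop (w : seq P) n i v :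
  (forall k, k <= n <-> k <= size w /\ W (drop k w)) -> i <= n ->
  reach (tail_order W) (drop i w) v <-> exists2 k, i <= k <= n & v = drop k w.
Proof.
move=> dom ni; have [iw Wi] := (dom i).1 ni; split.
  case=> [-> | [_ Wv _ [a [b [_ [bw Ev] _]]]]]; first by exists i; rewrite ?leqnn.
  move: Ev bw; rewrite drop_drop size_drop => Ev bw; exists (b + i) => //.
  by rewrite leq_addl; apply/dom; rewrite -Ev; split=> //; lia.
case=> k /andP[ik kn] ->; move: ik; rewrite leq_eqVlt => /predU1P[-> | ik].
  by left.
have [kw Wk] := (dom k).1 kn.
by right; apply/tail_order_drop => //; apply: ltnW.
Qed.

Lemma denot_sat V (w : seq P) n p i :
  (forall k, k <= n <-> k <= size w /\ W (drop k w)) -> i <= n ->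
  denot W (tail_order W) V p (drop i w) <->
  sat (fun j k => V j (drop k w)) n p i.
Proof.
move=> dom; elim: p i => [k | p IHp | p IHp q IHq | p IHp q IHq] i ni.
- by split=> [[] | ] // ?; split=> //; case: ((dom i).1 ni).
- split=> [[_ H] | /= /negP H]; first by apply/negP => /(IHp i ni).
  by split; [case: ((dom i).1 ni) | move/(IHp i ni)].
- split=> [[/(IHp i ni) /= -> /(IHq i ni)] // | /= /andP[pi qi]].
  by split; [apply/(IHp i ni) | apply/(IHq i ni)].
have [iw Wi] := (dom i).1 ni.
have ord a b : i <= a <= n -> i <= b <= n ->
    tail_order W (drop i w) (drop a w) (drop b w) <-> a < b.
  move=> /andP[ia an] /andP[ib bn].
  have [? ?] := (dom a).1 an; have [? ?] := (dom b).1 bn.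
  exact: tail_order_drop.
split=> [[_ H] | /sat_CondP H].
  apply/sat_CondP => k /andP[ik kn] pk min_k.
  have Rk : reach (tail_order W) (drop i w) (drop k w).
    by apply/(reach_drop _ dom) => //; exists k; rewrite ?ik.
  case: H => [H | [y [[Ry py] qy] min_y]].
    have : set0 (drop k w) by rewrite -H; split=> //; apply/IHp.
    by [].
  have /(reach_drop _ dom ni)[m /andP[im mn] Ey] := Ry; move: py qy min_y; rewrite {y Ry}Ey.
  move=> /(IHp _ mn) pm /(IHq _ mn) qm min_m.
  suff -> : k = m by [].
  have [km | mk | //] := ltngtP k m.
    by case: (min_m (drop k w)); [apply/ord; rewrite ?ik ?im | apply/IHp].
  by have := min_k m; rewrite im mk pm => /(_ isT).
split=> //; have [[k /andP[ik kn] pk] | nex] :=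
  pselect (exists2 k, i <= k <= n & sat (fun j k => V j (drop k w)) n p k).
  have [m [/andP[im mk] pm min_m]] := first_occurrence ik pk.
  have mn := leq_trans mk kn.
  right; exists (drop m w).
    split; last by apply/IHq => //; apply: H; rewrite ?im.
    split; last by apply/IHp.
    by apply/(reach_drop _ dom) => //; exists m; rewrite ?im.
  move=> x xm px.
  have [a /andP[ia an] Ex] : exists2 k, i <= k <= n & x = drop k w.
    apply/(reach_drop _ dom) => //.
    case: (xm) => Wx _ _ [a [b [[aw Ex] _ _]]].
    have [a0 | a_gt0] := posnP a; first by left; rewrite Ex a0 drop0.
    right; split=> //; exists 0, a; split=> //; split=> //; by rewrite drop0.
  move: xm px; rewrite Ex => /ord am /(IHp _ an); apply/negP/min_m.
  by rewrite ia am ?ia ?im.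
left; rewrite -subset0 => x -[] /(reach_drop _ dom ni)[k ik ->].
by case/andP: (ik) => _ kn /(IHp _ kn) pk; case: nex; exists k.
Qed.

End ListFrames.

Lemma list_frame_order (P : Type) (W : set (seq P)) : (W !=set0)%classic ->
  order_frame W (tail_order W).
Proof.
move=> W0; split=> // [w Ww | w x y _ [Wx Wy Ww [a [b [[aw Ex] _ _]]]]]; last first.
  have [a0 | a_gt0] := posnP a; first by left; rewrite Ex a0 drop0.
  by right; split=> //; exists 0, a; split; rewrite // /tail_at drop0.
exists [set t | W t /\ exists k, tail_at w k t]%classic; first by move=> t [].
split.
- by move=> x y [Wx Wy _ [a [b [ax bx _]]]]; split; split=> //; [exists a | exists b].
- move=> x [_ _ _ [a [b [[aw Ea] [bw]]]]].
  by rewrite Ea => /(congr1 size); rewrite !size_drop; lia.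
- move=> x y z [Wx Wy _ [a [b [ax [bw Eb] ab]]]] [_ Wz _ [c [d [[cw Ec] dz cd]]]].
  split=> //; exists a, d; split=> //.
  by move: Ec; rewrite Eb => /(congr1 size); rewrite !size_drop; lia.
- move=> x y [Wx [a ax]] [Wy [b bx]]; have [ab | ba | ab] := ltngtP a b.
  + by constructor 1; split=> //; exists a, b.
  + by constructor 3; split=> //; exists b, a.
  + by constructor 2; case: ax bx => _ -> [_ ->]; rewrite ab.
move=> A AS [x0 Ax0].
have [_ [k0 [k0w Ek0]]] := AS _ Ax0.
(* The least element of [A] is its tail of smallest rank. *)
have [m [_ /asboolP[mw Am] min_m]] :=
  first_occurrence (P := fun k => `[< k <= size w /\ A (drop k w) >]) (leq0n k0)
    ltac:(by apply/asboolP; rewrite -Ek0).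
exists (drop m w) => // x Ax xm; have [Wx [k [kw Ek]]] := AS _ Ax.
split=> //; first by have [] := AS _ Am.
exists m, k; split=> //; rewrite ltn_neqAle; apply/andP; split.
  by apply/eqP => mk; apply: xm; rewrite mk.
rewrite leqNgt; apply/negP => km; have := min_m k; rewrite km => /(_ isT)/asboolP.
by apply; rewrite -Ek.
Qed.

Lemma finitely_valid_list (P : Type) (W : set (seq P)) V p w :
  finitely_valid p -> list_frame W -> W w -> denot W (tail_order W) V p w.
Proof.
move=> val [_ tails] Ww.
have dom n : (forall k, k <= n <-> k <= size w /\ W (drop k w)) ->
    denot W (tail_order W) V p w.
  by move=> dom; have /(denot_sat V p dom) := leq0n n; rewrite drop0 => ->; apply: val.
have Wk k : k < size w -> W (drop k w).
  move=> kw; apply: (tails w k) => //; first by split=> //; apply: ltnW.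
  by move/(congr1 size); rewrite size_drop /=; lia.
have [Wnil | nWnil] := pselect (W [::]).
  apply: (dom (size w)) => k; split=> [kw | []//]; split=> //.
  by have [/Wk // | wk] := ltnP k (size w); rewrite drop_oversize.
apply: (dom (size w).-1) => k.
have w0 : 0 < size w by case: (w) Ww => // /nWnil.
split=> [kw | [kw Wdk]]; first by split; [lia | apply: Wk; lia].
suff : k != size w by lia.
by apply/eqP => kE; apply: nWnil; rewrite -(drop_size w) -kE.
Qed.

Lemma list_valid_finite p :
  (forall (P : Type) (W : set (seq P)) (V : nat -> seq P -> bool),
     inhabited P -> list_frame W ->
     forall w : seq P, W w -> denot W (tail_order W) V p w) ->
  finitely_valid p.
Proof.
move=> val V n i ni.
(* One-letter lists suffice: a tail is determined by its length, from which [U] recovers the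
   position. *)
pose W : set (seq unit) := [set t | t <> [::]]%classic.
pose U k (t : seq unit) := V k (n.+1 - size t).
pose w := nseq n.+1 tt.
have dom k : k <= n <-> k <= size w /\ W (drop k w).
  rewrite size_nseq drop_nseq; split=> [kn | [_ Wk]].
    by split; [lia | rewrite (_ : n.+1 - k = (n - k).+1) //; lia].
  by rewrite leqNgt; apply/negP => nk; apply: Wk; rewrite (_ : n.+1 - k = 0) //; lia.
have Wlist : list_frame W.
  by split=> [|s k t]; [apply: list_frame_order; exists [:: tt] | ].
have := val unit W U (inhabits tt) Wlist _ ((dom i).1 ni).2.
move/(denot_sat U p dom ni).
suff -> : (fun j k => U j (drop k w)) = (fun j k => V j (n.+1 - (n.+1 - k))).
  (* Subtraction truncates, so the two valuations can differ beyond the sequence; they are compared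
     only at [k <= n]. *)
  set V' := (fun _ _ => _).
  have : forall q k, k <= n -> sat V' n q k = sat V n q k.
    elim=> [j | q IH | q IHq r IHr | q IHq r IHr] k kn /=.
    - by rewrite /V' subKn //; lia.
    - by rewrite IH.
    - by rewrite IHq ?IHr.
    apply/asboolP/asboolP => H m /andP[km mn] qm min_m.
      rewrite -IHr //; apply: H; rewrite ?IHq ?km // => j jm.
      by rewrite IHq; [apply: min_m | lia].
    rewrite IHr //; apply: H; rewrite -?IHq ?km // => j jm.
    by rewrite -IHq; [apply: min_m | lia].
  by move=> ->.
by apply/funext => j; apply/funext => k; rewrite /U drop_nseq size_nseq.
Qed.

(** * Maximal consistent sets *)

Definition boolean (v : form -> bool) : Prop :=
  (forall p, v (Neg p) = ~~ v p) /\ (forall p q, v (And p q) = v p && v q).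

Lemma boolean_Imp v p q : boolean v -> v (Imp p q) = (v p ==> v q).
Proof. by case=> vN vA; rewrite vN vA vN; case: (v p); case: (v q). Qed.

Lemma boolean_Or v p q : boolean v -> v (Or p q) = v p || v q.
Proof. by case=> vN vA; rewrite vN vA !vN; case: (v p); case: (v q). Qed.

Lemma boolean_Iff v p q : boolean v -> v (Iff p q) = (v p == v q).
Proof.
by move=> bv; rewrite (proj2 bv) !boolean_Imp //; case: (v p); case: (v q).
Qed.

(** Conditionals, like atoms, count as propositional variables named by their codes; decoding the
    variables makes any formula a substitution instance of its skeleton. *)
Fixpoint skeleton (p : form) : pform :=
  match p with
  | Neg q => PNeg (skeleton q)
  | And q r => PAnd (skeleton q) (skeleton r)
  | _ => PVar (pickle p)
  end.

Lemma skeletonK : cancel skeleton (psubst (fun k => odflt (Atom 0) (unpickle k))).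
Proof. by elim=> /= [k|p ->|p -> q ->|p _ q _] //; rewrite pickleK. Qed.

Lemma C2FSM_C2 p : C2_axiom p -> C2FSM p.
Proof. by move=> ax; do 2![apply: Axiom_instance; left]; apply: Axiom_instance. Qed.

Lemma C2FSM_MP p q : C2FSM (Imp p q) -> C2FSM p -> C2FSM q.
Proof. exact: Detachment. Qed.

Lemma C2FSM_boolean p : (forall v, boolean v -> v p) -> C2FSM p.
Proof.
move=> H; rewrite -(skeletonK p); apply/C2FSM_C2/PC => v.
apply: (H (fun q => peval v (skeleton q))).
by split.
Qed.

Lemma C2FSM_boolean1 p q :
  (forall v, boolean v -> v p -> v q) -> C2FSM p -> C2FSM q.
Proof.
move=> H; apply: C2FSM_MP; apply: C2FSM_boolean => v bv.
by rewrite boolean_Imp //; apply/implyP/H.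
Qed.

Lemma C2FSM_boolean2 p q r :
  (forall v, boolean v -> v p -> v q -> v r) -> C2FSM p -> C2FSM q -> C2FSM r.
Proof.
move=> H Hp; apply: C2FSM_MP; apply: C2FSM_boolean1 Hp => v bv vp.
by rewrite boolean_Imp //; apply/implyP/H.
Qed.

(* Maximal consistent sets, as characteristic functions. *)
Definition world (v : form -> bool) : Prop :=
  boolean v /\ forall p, C2FSM p -> v p.

Section Lindenbaum.
Variable p : form.
Hypothesis p_unprovable : ~ C2FSM p.

(** Stage [n.+1] settles the formula with code [n]; a code of no formula settles [p] again, which
    does no harm. *)
Fixpoint stage (n : nat) : form :=
  if n is m.+1 then
    let q := odflt p (unpickle m) in
    if `[< C2FSM (Neg (And (stage m) q)) >] then And (stage m) (Neg q)
    else And (stage m) q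
  else Neg p.

Lemma stage_consistent n : ~ C2FSM (Neg (stage n)).
Proof.
elim: n => [|n IHn] /=.
  by apply: contra_not p_unprovable; apply: C2FSM_boolean1 => v [vN _]; rewrite !vN negbK.
case: asboolP => // H; apply: contra_not IHn => H'.
apply: C2FSM_boolean2 H H' => v [vN vA]; rewrite !vN !vA vN.
by case: (v (stage n)); case: (v _).
Qed.

Lemma stage_le m n : m <= n -> C2FSM (Imp (stage n) (stage m)).
Proof.
elim: n => [|n IHn].
  by rewrite leqn0 => /eqP ->; apply: C2FSM_boolean => v bv; rewrite boolean_Imp // implybb.
rewrite leq_eqVlt => /predU1P[-> | /IHn].
  by apply: C2FSM_boolean => v bv; rewrite boolean_Imp // implybb.
apply: C2FSM_boolean1 => v bv; rewrite !boolean_Imp //=.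
by case: ifP => _; rewrite (proj2 bv); case: (v (stage n)); case: (v _); case: (v _).
Qed.

Lemma Lindenbaum : exists2 v, world v & ~~ v p.
Proof.
pose v q := `[< exists n, C2FSM (Imp (stage n) q) >].
(* Premises proved at two stages are both available at the later one. *)
have vE q1 q2 r : (forall u, boolean u -> u q1 -> u q2 -> u r) -> v q1 -> v q2 -> v r.
  move=> H /asboolP[m Hm] /asboolP[n Hn]; apply/asboolP; exists (maxn m n).
  have Hm' := stage_le (leq_maxl m n); have Hn' := stage_le (leq_maxr m n).
  have K1 : C2FSM (Imp (stage (maxn m n)) q1).
    apply: C2FSM_boolean2 Hm' Hm => u bu; rewrite !boolean_Imp //.
    by move=> /implyP a /implyP b; apply/implyP => /a/b.
  have K2 : C2FSM (Imp (stage (maxn m n)) q2).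
    apply: C2FSM_boolean2 Hn' Hn => u bu; rewrite !boolean_Imp //.
    by move=> /implyP a /implyP b; apply/implyP => /a/b.
  apply: C2FSM_boolean2 K1 K2 => u bu; rewrite !boolean_Imp //.
  by move=> /implyP a /implyP b; apply/implyP => c; apply: H (a c) (b c).
have vth q : C2FSM q -> v q.
  move=> Hq; apply/asboolP; exists 0; apply: C2FSM_boolean1 Hq => u bu uq.
  by rewrite boolean_Imp // uq implybT.
have vN q : v (Neg q) = ~~ v q.
  apply/idP/idP.
    apply: contraL => vq; apply/negP => vNq.
    have /asboolP[n Hn] : v (And q (Neg q)).
      by apply: vE vq vNq => u [uN uA] uq uNq; rewrite uA uq uNq.
    apply: (@stage_consistent n); apply: C2FSM_boolean1 Hn => u bu.
    by rewrite boolean_Imp // (proj2 bu) !(proj1 bu); case: (u q); case: (u _).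
  apply: contraNT => nvNq; apply/asboolP; exists (pickle q).+1 => /=.
  rewrite pickleK /=; case: asboolP => H.
    case/negP: nvNq; apply/asboolP; exists (pickle q).
    apply: C2FSM_boolean1 H => u bu.
    by rewrite boolean_Imp // !(proj1 bu) (proj2 bu); case: (u q); case: (u _).
  apply: C2FSM_boolean => u bu.
  by rewrite boolean_Imp // (proj2 bu); case: (u q); case: (u _).
exists v; first split=> //.
  split=> // q r; apply/idP/andP => [vqr | [vq vr]].
    by split; apply: (vE _ _ _ _ vqr vqr) => u [uN uA]; rewrite uA => /andP[].
  by apply: vE vq vr => u [uN uA]; rewrite uA => -> ->.
rewrite -vN; apply/asboolP; exists 0; apply: C2FSM_boolean => u bu.
by rewrite boolean_Imp // implybb.
Qed.

End Lindenbaum.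

(** Derivability can now be read off worlds; in particular, Normality can be used with an entailment
    over all worlds as its premise. *)
Lemma C2FSM_worlds p : (forall v, world v -> v p) -> C2FSM p.
Proof.
move=> H; apply: contrapT => np; have [v wv] := Lindenbaum np.
by rewrite H.
Qed.

(** * Laws of the conditional at a world *)

Section Worlds.
Variable v : form -> bool.
Hypothesis wv : world v.

Lemma worldN p : v (Neg p) = ~~ v p. Proof. exact: wv.1.1. Qed.
Lemma worldA p q : v (And p q) = v p && v q. Proof. exact: wv.1.2. Qed.
Lemma worldI p q : v (Imp p q) = (v p ==> v q).
Proof. exact: boolean_Imp wv.1. Qed.
Lemma worldO p q : v (Or p q) = v p || v q.
Proof. exact: boolean_Or wv.1. Qed.
Lemma worldE p q : v (Iff p q) = (v p == v q).
Proof. exact: boolean_Iff wv.1. Qed.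

Lemma cond_normal s p q r :
  (forall u, world u -> u p -> u q -> u r) ->
  v (Cond s p) -> v (Cond s q) -> v (Cond s r).
Proof.
move=> H sp sq.
have : C2FSM (Imp (And (Cond s p) (Cond s q)) (Cond s r)).
  apply: Normality; apply: C2FSM_worlds => u wu.
  rewrite boolean_Imp ?(proj2 wu.1); last exact: wu.1.
  by apply/implyP => /andP[]; apply: H.
by move/wv.2; rewrite worldI worldA sp sq.
Qed.

Lemma cond_id p : v (Cond p p).
Proof. exact/wv.2/C2FSM_C2/Identity. Qed.

Lemma cond_mono s p q :
  (forall u, world u -> u p -> u q) -> v (Cond s p) -> v (Cond s q).
Proof. by move=> H sp; apply: (cond_normal _ sp sp) => u wu up _; apply: H. Qed.

Lemma cond_entail p q : (forall u, world u -> u p -> u q) -> v (Cond p q).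
Proof. by move=> H; apply: (cond_mono H); apply: cond_id. Qed.

Lemma cond_reciprocity p q r :
  v (Cond p q) -> v (Cond q p) -> v (Cond p r) -> v (Cond q r).
Proof.
move=> pq qp pr; have := wv.2 _ (C2FSM_C2 (Reciprocity p q r)).
by rewrite worldI !worldA pq qp pr.
Qed.

Lemma cond_equiv p q r :
  (forall u, world u -> u p = u q) -> v (Cond p r) = v (Cond q r).
Proof.
move=> H; have pq : v (Cond p q) by apply: cond_entail => u wu; rewrite H.
have qp : v (Cond q p) by apply: cond_entail => u wu; rewrite H.
by apply/idP/idP; apply: cond_reciprocity.
Qed.

Lemma cond_MP p q : v (Cond p q) -> v p -> v q.
Proof.
move=> pq vp; have := wv.2 _ (C2FSM_C2 (MP p q)).
by rewrite !worldI pq vp.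
Qed.

Lemma cond_CEM p q : v (Cond p q) || v (Cond p (Neg q)).
Proof. by rewrite -worldO; apply/wv.2/C2FSM_C2/CEM. Qed.

Lemma cond_true p q : v p -> v (Cond p q) = v q.
Proof.
move=> vp; apply/idP/idP => [/cond_MP -> // | vq].
by case/orP: (cond_CEM p q) => // /cond_MP/(_ vp); rewrite worldN vq.
Qed.

(** The premise expresses that [p] is impossible, the vacuous case of the conditional. *)
Lemma cond_absurd p q : v (Cond p (Neg p)) -> v (Cond p q).
Proof.
move=> pNp; apply: cond_normal (cond_id p) pNp => u wu up.
by rewrite wu.1.1 up.
Qed.

End Worlds.

(** The entailment makes [q] equivalent to the [And p q] of the schema. In terms of selection,
    moving to the nearest [p]-world does not change conditionals whose antecedent entails [p]. *)
Lemma cond_flattening v p q r : world v -> (forall u, world u -> u q -> u p) ->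
  v (Cond p (Cond q r)) = v (Cond q r).
Proof.
move=> wv qp.
have E u : world u -> u (Cond (And p q) r) = u (Cond q r).
  move=> wu; apply: cond_equiv => // u' wu'; rewrite (worldA wu').
  by have := qp u' wu'; case: (u' p); case: (u' q) => // ->.
have /(wv.2) : C2FSM (Iff (Cond p (Cond (And p q) r)) (Cond (And p q) r)).
  by apply/Axiom_instance; left; apply/Axiom_instance; right; left.
rewrite (worldE wv) E // => /eqP <-.
by apply/idP/idP; apply: cond_mono => // u wu; rewrite E.
Qed.

Lemma cond_sequentiality v p q r : world v ->
  v (Box (Imp p (Cond (Neg p) r))) -> v (Box (Imp q (Cond (Neg q) r))) ->
  v (Or p q) -> v (Cond (Neg (Or p q)) r).
Proof.
move=> wv bp bq vpq.
have /(wv.2) : C2FSM (Imp (And (Box (Imp p (Cond (Neg p) r)))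
    (Box (Imp q (Cond (Neg q) r)))) (Imp (Or p q) (Cond (Neg (Or p q)) r))).
  by apply/Axiom_instance; left; apply/Axiom_instance; right; right.
by rewrite (worldI wv) (worldA wv) bp bq implyTb (worldI wv) vpq.
Qed.

(** * Accessibility *)

(** The canonical selection function: the consequents of [p] at [v] form the nearest world
    satisfying [p], provided that [p] is possible at [v]. *)
Definition select (v : form -> bool) (p q : form) : bool := v (Cond p q).

Definition acc (v u : form -> bool) : Prop := forall p, v (Box p) -> u p.

(** CEM makes the selected set complete; the possibility of [p] makes it consistent. *)
Lemma select_world v p : world v -> ~~ v (Cond p (Neg p)) -> world (select v p).
Proof.
rewrite /select => wv ndp; split; last first.
  by move=> q Hq; apply: cond_entail => // u wu _; apply: wu.2.
split=> [q | q r].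
  have /orP[pq | pNq] := cond_CEM wv p q.
    rewrite pq; apply/negbTE; apply: contra ndp => pNq.
    by apply: (cond_normal wv _ pq pNq) => u wu uq; rewrite (worldN wu) uq.
  rewrite pNq; apply/esym; apply: contra ndp => pq.
  by apply: (cond_normal wv _ pq pNq) => u wu uq; rewrite (worldN wu) uq.
apply/idP/andP => [pqr | [pq pr]].
  by split; move: pqr; apply: cond_mono => // u wu; rewrite (worldA wu) => /andP[].
by apply: (cond_normal wv _ pq pr) => u wu uq ur; rewrite (worldA wu) uq ur.
Qed.

(** Otherwise CEM gives [Cond p (Neg q)]. Then Reciprocity exchanges the antecedents [p] and [s],
    and also [s] and [Neg q]; the latter is impossible and so has every consequent. *)
Lemma Box_cond v p q : world v -> v (Box q) -> v (Cond p q).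
Proof.
move=> wv bq; have /orP[// | pNq] := cond_CEM wv p q.
pose s := And p (Neg q).
have Nq r : v (Cond (Neg q) r).
  apply: cond_absurd => //; apply: (cond_mono wv _ bq) => u wu uq.
  by rewrite !(worldN wu) negbK.
have sq : v (Cond s q).
  apply: (cond_reciprocity wv (Nq s)) (Nq q).
  by apply: cond_entail => // u wu; rewrite (worldA wu) => /andP[].
apply: (cond_reciprocity wv _ _ sq).
  by apply: cond_entail => // u wu; rewrite (worldA wu) => /andP[].
by apply: (cond_normal wv _ (cond_id wv p) pNq) => u wu up uq; rewrite (worldA wu) up uq.
Qed.

Lemma acc_select v p : world v -> acc v (select v p).
Proof. by move=> wv q; apply: Box_cond. Qed.

Lemma Box_theorem v p : world v -> C2FSM p -> v (Box p).
Proof. by move=> wv Hp; apply: cond_entail => // u wu _; apply: wu.2. Qed.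

Lemma acc_refl v : world v -> acc v v.
Proof.
move=> wv p bp; apply: contraT => np; rewrite -(negPf np).
by apply: (cond_MP wv bp); rewrite (worldN wv).
Qed.

(* An instance of Flattening, since [¬ p] entails [¬ □ p]. *)
Lemma Box_Box v p : world v -> v (Box (Box p)) = v (Box p).
Proof.
move=> wv; apply: cond_flattening => // u wu.
by rewrite !(worldN wu); apply: contra; apply: acc_refl.
Qed.

Lemma acc_Box v u p : world v -> acc v u -> v (Box p) -> u (Box p).
Proof. by move=> wv vu; rewrite -Box_Box //; apply: vu. Qed.

Lemma acc_trans v u w : world v -> acc v u -> acc u w -> acc v w.
Proof. by move=> wv vu uw p /(acc_Box wv vu); apply: uw. Qed.

Lemma Box_witness v p : world v -> ~~ v (Box p) ->
  exists u, [/\ world u, acc v u & ~~ u p].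
Proof.
move=> wv nbp; exists (select v (Neg p)).
have wu : world (select v (Neg p)).
  apply: select_world => //; apply: contra nbp; apply: cond_mono => // u wu.
  by rewrite !(worldN wu) negbK.
by split=> //; apply: acc_select.
Qed.

(** The formulas are settled one at a time, as necessity persists under [acc]. If [p] is not
    possibly necessary, McKinsey denies that it is necessarily possible, so some accessible world
    has [Box (Neg p)]. *)
Lemma McKinsey_decided v (ps : seq form) : world v ->
  exists u, [/\ world u, acc v u &
    forall p, p \in ps -> u (Box p) || u (Box (Neg p))].
Proof.
move=> wv; elim: ps => [|p ps [u [wu vu ups]]]; first by exists v; split=> //; apply: acc_refl.
suff [w [ww uw wp]] : exists w, [/\ world w, acc u w & w (Box p) || w (Box (Neg p))].
  exists w; split=> // [|q]; first exact: acc_trans uw.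
  rewrite inE => /predU1P[-> // | /ups /orP[] uq]; apply/orP; [left | right].
    exact: acc_Box uw uq.
  exact: acc_Box uw uq.
have [dbp | ndbp] := boolP (u (Dia (Box p))).
  have [w [ww uw]] : exists w, [/\ world w, acc u w & ~~ w (Neg (Box p))].
    by apply: Box_witness; rewrite // -(worldN wu).
  by rewrite (worldN ww) negbK => wp; exists w; rewrite wp.
have [w [ww uw]] : exists w, [/\ world w, acc u w & ~~ w (Dia p)].
  apply: Box_witness => //; apply: contra ndbp => bdp.
  have /(wu.2) : C2FSM (Imp (Box (Dia p)) (Dia (Box p))) by apply: Axiom_instance; right.
  by rewrite (worldI wu) bdp.
by rewrite (worldN ww) negbK => wp; exists w; rewrite wp orbT.
Qed.

(** * Reaching a terminal type *)

(** State descriptions; the fallback branch is the empty conjunction, a tautology. *)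
Fixpoint chi (s : seq form) (a : seq bool) : form :=
  match s, a with
  | p :: s', b :: a' => And (if b then p else Neg p) (chi s' a')
  | _, _ => Neg (And (Atom 0) (Neg (Atom 0)))
  end.

Lemma world_chi v s a : world v -> size a = size s -> v (chi s a) = (map v s == a).
Proof.
move=> wv; elim: s a => [|p s IHs] [|b a] //= => [_ | [sa]].
  by rewrite (worldN wv) (worldA wv) (worldN wv); case: (v _).
rewrite (worldA wv) IHs // eqseq_cons; congr (_ && _).
by case: b; rewrite ?(worldN wv); case: (v p).
Qed.

Definition disj : seq form -> form := foldr Or (And (Atom 0) (Neg (Atom 0))).

Lemma world_disj v s : world v -> v (disj s) = has v s.
Proof.
move=> wv; elim: s => [|p s IHs] /=; last by rewrite (worldO wv) IHs.
by rewrite (worldA wv) (worldN wv); case: (v _).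
Qed.

(** The assumption on the members of [s] is made for all worlds, so that the two implications in
    Sequentiality are theorems and may be boxed. *)
Lemma disj_sequentiality v (s : seq form) r : world v ->
  (forall p u, p \in s -> world u -> u p -> u (Cond (Neg p) r)) ->
  v (disj s) -> v (Cond (Neg (disj s)) r).
Proof.
move=> wv; elim: s v wv => [|p s IHs] v wv H; first by rewrite world_disj.
apply: cond_sequentiality => //; apply: Box_theorem => //; apply: C2FSM_worlds => u wu;
    rewrite (worldI wu); apply/implyP.
  by apply: H; rewrite ?mem_head.
by apply: IHs => // q w qs; apply: H; rewrite inE qs orbT.
Qed.

Fixpoint subforms (p : form) : seq form :=
  p :: match p with
       | Atom _ => [::]
       | Neg q => subforms q
       | And q r | Cond q r => subforms q ++ subforms r
       end.

Lemma subforms_refl p : p \in subforms p.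
Proof. by case: p => *; rewrite /= mem_head. Qed.

Lemma subforms_Cond r p q : Cond p q \in subforms r -> p \in subforms r.
Proof.
elim: r => [k | r IH | r IHr t IHt | r IHr t IHt] /=; rewrite !inE ?mem_cat //.
- by case/predU1P=> [// | /IH ->]; rewrite orbT.
- by case/predU1P=> [// | /orP[/IHr -> | /IHt ->]]; rewrite ?orbT.
by case/predU1P=> [[<- _] | /orP[/IHr -> | /IHt ->]]; rewrite ?subforms_refl ?orbT.
Qed.

(** * Types and good steps *)

Section Types.
Variable s : seq form.

Let type := (size s).-tuple bool.

Definition type_of (v : form -> bool) : type := map_tuple v (in_tuple s).

(** The default [false] is reached for formulas outside [s], such as atoms foreign to the given
    sentence. *)
Definition holds (a : type) (p : form) : bool := nth false a (index p s).

Lemma holds_type_of v p : p \in s -> holds (type_of v) p = v p.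
Proof. by move=> ps; rewrite /holds (nth_map p) ?index_mem // nth_index. Qed.

Lemma chi_type_of v (a : type) : world v -> v (chi s a) = (type_of v == a).
Proof. by move=> wv; rewrite world_chi // size_tuple. Qed.

Definition step_ok (a b : type) (f : form) : bool :=
  if f is Cond p _ then holds a p || (holds a f == holds b f) else true.

Definition end_ok (a : type) (f : form) : bool :=
  if f is Cond p _ then holds a p || holds a f else true.

Definition step : rel type := fun a b =>
  all (step_ok a b) s && `[< exists2 v, world v & type_of v = b >].

Hypothesis s_closed : forall p q, Cond p q \in s -> p \in s.

(** If the antecedent [p] of a conditional in [s] is false in type [a], then [p] entails
    [Neg (chi s a)], and Flattening preserves the conditional at the nearest world of another
    type. *)
Lemma step_select v (a : type) : world v -> type_of v = a ->
  ~~ v (Cond (Neg (chi s a)) (Neg (Neg (chi s a)))) ->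
  step a (type_of (select v (Neg (chi s a)))).
Proof.
move=> wv va nd.
have wu := select_world wv nd; apply/andP; split; last first.
  by apply/asboolP; exists (select v (Neg (chi s a))).
apply/allP => -[] //= p q pqs; rewrite -va !holds_type_of ?(s_closed pqs) //.
have [// | np] := boolP (v p); rewrite orFb /select cond_flattening //.
move=> u wu' up; rewrite (worldN wu') chi_type_of //; apply: contra np => /eqP ua.
by rewrite -holds_type_of ?(s_closed pqs) // -ua holds_type_of ?(s_closed pqs).
Qed.

Lemma terminal_reachable v : world v ->
  exists2 a, connect step (type_of v) a & all (end_ok a) s.
Proof.
move=> wv; pose S := [set a | connect step (type_of v) a]%SET.
pose psi := disj [seq chi s (a : type) | a <- enum S].
have psiE u : world u -> u psi = (type_of u \in S).
  move=> wu; rewrite world_disj // has_map; apply/hasP/idP => [[a] | uS].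
    by rewrite mem_enum /= chi_type_of // => aS /eqP ->.
  by exists (type_of u); [rewrite mem_enum | rewrite /preim inE chi_type_of].
have vpsi : v psi by rewrite psiE // inE connect0.
(* [Box psi] is the conditional from [Neg psi] to [psi], so Sequentiality applies with [psi] itself
   as the consequent. *)
have bpsi : v (Box psi).
  apply: disj_sequentiality => // _ u /mapP[a aS ->] wu.
  rewrite chi_type_of // => /eqP ua.
  (* Either a type other than [a] is impossible at [u], and the conditional is vacuous, or the
     nearest world of another type has a type one step from [a]. *)
  have [|nd] := boolP (u (Cond (Neg (chi s a)) (Neg (Neg (chi s a))))).
    exact: cond_absurd.
  rewrite -[X in is_true X]/(select u (Neg (chi s a)) psi) psiE; last exact: select_world.
  move: aS; rewrite mem_enum !inE => /connect_trans; apply; apply: connect1.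
  exact: step_select.
have [u [wu vu dec]] := McKinsey_decided s wv.
have := vu _ bpsi; rewrite psiE // inE => uS; exists (type_of u) => //.
apply/allP => -[] //= p q pqs; have ps := s_closed pqs.
(* A necessary antecedent is true at [u]; an impossible one makes the conditional vacuous. *)
rewrite !holds_type_of //; case/orP: (dec p ps) => bp.
  by rewrite (acc_refl wu bp).
apply/orP; right; apply: cond_absurd => //; exact: Box_cond.
Qed.

(** Each type on the path is realised by a world, which settles the Boolean connectives and the
    conditionals with true antecedent. Other conditionals are passed on to the next position by
    [step_ok], and settled at the last one by [end_ok]. *)
Lemma path_sat v (r : seq type) (a := type_of v) (A := nth a (a :: r)) p :
  world v -> path step a r -> all (end_ok (last a r)) s ->
  {subset subforms p <= s} ->
  forall i, i <= size r ->
  sat (fun k j => holds (A j) (Atom k)) (size r) p i = holds (A i) p.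
Proof.
move=> wv /(pathP a) r_path r_end; set V := fun _ _ => _; set n := size r.
have A_world i : i <= n -> exists2 u, world u & type_of u = A i.
  by case: i => [|i] ni; [exists v | have /andP[_ /asboolP] := r_path i ni].
elim: p => [// | p IHp | p IHp q IHq | p IHp q IHq] ps i ni.
- have [u wu uA] := A_world i ni.
  have p_s : p \in s by apply: ps; rewrite inE subforms_refl orbT.
  rewrite /= IHp // => [|q pq]; last by apply: ps; rewrite inE pq orbT.
  by rewrite -uA !holds_type_of ?(worldN wu) ?p_s ?ps ?subforms_refl.
- have [u wu uA] := A_world i ni.
  have p_s : {subset subforms p <= s}.
    by move=> f fp; apply: ps; rewrite inE mem_cat fp orbT.
  have q_s : {subset subforms q <= s}.
    by move=> f fq; apply: ps; rewrite inE mem_cat fq !orbT.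
  have pq1 := ps _ (subforms_refl _); have p1 := p_s _ (subforms_refl _).
  have q1 := q_s _ (subforms_refl _).
  by rewrite /= IHp // IHq // -uA !holds_type_of ?(worldA wu).
have p_s : {subset subforms p <= s}.
  by move=> f fp; apply: ps; rewrite inE mem_cat fp orbT.
have q_s : {subset subforms q <= s}.
  by move=> f fq; apply: ps; rewrite inE mem_cat fq !orbT.
have pq1 := ps _ (subforms_refl _); have p1 := p_s _ (subforms_refl _).
have q1 := q_s _ (subforms_refl _).
(* Descending induction on the position, starting from the last one. *)
elim: {i}(n - i) {-2}i ni (erefl (n - i)) => [|m IHm] i ni mE;
    rewrite sat_Cond_rec // IHp // IHq //; have [u wu uA] := A_world i ni;
    case: ifP => pi.
- by move: pi; rewrite -uA !holds_type_of // => /(cond_true wu) ->.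
- have -> : i = n by lia.
  rewrite eqxx /A -[nth _ _ _]/(nth a (a :: r) (size r)) nth_last /=.
  have /allP/(_ _ pq1) /= := r_end.
  have -> : last a r = A i by rewrite /A (_ : i = size r) ?nth_last //; lia.
  by rewrite pi orFb => ->.
- by move: pi; rewrite -uA !holds_type_of // => /(cond_true wu) ->.
have ltin : i < n by lia.
rewrite (negPf (_ : i != n)) ?IHm; [|lia..].
have /andP[/allP/(_ _ pq1) /= + _] := r_path i ltin.
by rewrite -/(A i) pi orFb => /eqP ->.
Qed.

End Types.

(** A world refuting [p] has a type from which a good path leads to a terminal one; that path
    refutes [p] at position [0]. *)
Lemma finitely_valid_C2FSM p : finitely_valid p -> C2FSM p.
Proof.
move=> val; apply: contrapT => /Lindenbaum[v wv].
have [_ /connectP[r r_path ->] r_end] := terminal_reachable (@subforms_Cond p) wv.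
rewrite -(holds_type_of v (subforms_refl p)).
by rewrite -(path_sat wv r_path r_end _ (leq0n _)) ?val.
Qed.

Theorem theorem6p4 (p : form) :
  C2FSM p <->
  (forall (P : Type) (W : set (seq P)) (V : nat -> seq P -> bool),
     inhabited P -> list_frame W ->
     forall w : seq P, W w -> denot W (tail_order W) V p w).
Proof.
split=> [/C2FSM_finitely_valid val P W V _ Wlist w | val].
  exact: finitely_valid_list.
exact/finitely_valid_C2FSM/list_valid_finite.
Qed.
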